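(* Let $n,m\ge1$, let $A\in\mathbb{R}^{n\times n}$, let $B\in\mathbb{R}^{n\times m}$ have full column rank, and assume that $(A,B)$ satisfies the Kalman rank condition. Let $t_s>0$, let $K_c\in\mathbb{R}^{m\times n}$ be such that $A_c:=A+BK_c$ satisfies $\mathrm{e}^{A_ct_s}=I$, and let $$W_t=\int_0^t \mathrm{e}^{-A_c\tau}BB^\top \mathrm{e}^{-A_c^\top\tau}\,\mathrm{d}\tau .$$ If $\varphi\in\mathrm{Diff}(\mathbb{R}^n)$ is such that the map $$\psi:\ x\mapsto W_{t_s}^{-\frac12}\varphi\big(W_{t_s}^{\frac12}x\big)-x$$ is a contraction, then there exists a (nonlinear) continuous feedback law $K:\mathbb{R}^n\times[0,t_s]\to\mathbb{R}^m$ such that $$u_t^\star=K(x_t^\star,t)$$ for all $x_{\mathrm{in}}\in\mathbb{R}^n$ and all $t\in[0,t_s]$, where $$x_t^\star=\mathrm{e}^{A_ct}\big(x_{\mathrm{in}}+W_tW_{t_s}^{-1}(\varphi(x_{\mathrm{in}})-x_{\mathrm{in}})\big),\qquad u_t^\star=B^\top \mathrm{e}^{-A_c^\top t}W_{t_s}^{-1}(\varphi(x_{\mathrm{in}})-x_{\mathrm{in}}).$$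
   Context: The pair $(A,B)$ satisfies the Kalman rank condition if $\mathrm{rank}[B, AB,\dots,A^{n-1}B]=n$; under this condition $W_{t_s}$ is symmetric positive definite, and powers $W_{t_s}^{\pm 1/2}$ are of the symmetric positive definite square root. $\mathrm{Diff}(\mathbb{R}^n)$ is the group of diffeomorphisms of $\mathbb{R}^n$. A contraction is a map $\psi:\mathbb{R}^n\to\mathbb{R}^n$ that is Lipschitz with constant strictly less than $1$ in the Euclidean norm. The pair $(x^\star_\cdot,u^\star_\cdot)$ is the optimal state trajectory and open-loop input for $\dot x=A_cx+Bu$ that minimizes $\int_0^{t_s}\|u_t\|^2\,\mathrm{d}t$ while steering $x_{\mathrm{in}}$ at time $0$ to $\varphi(x_{\mathrm{in}})$ at time $t_s$. *)

(* Defs.v *)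
From mathcomp Require Import all_boot all_order all_algebra.
From mathcomp Require Import all_classical all_reals all_analysis.
Import Order.TTheory GRing.Theory Num.Theory.
Import numFieldNormedType.Exports.

Set Implicit Arguments.
Unset Strict Implicit.
Unset Printing Implicit Defensive.

Local Open Scope classical_set_scope.
Local Open Scope ring_scope.

(* MathComp-Analysis; R^n is 'cV[R]_n, whose library topology (that of the sup
   norm) is the usual one. *)

Definition expmx (R : realType) (n : nat) (A : 'M[R]_n) : 'M[R]_n :=
  limn (series (fun k : nat => (k`!%:R)^-1 *: A ^+ k)).

Definition int_mx (R : realType) (p q : nat) (F : R -> 'M[R]_(p, q)) (a b : R) :
    'M[R]_(p, q) :=
  \matrix_(i, j) \int[@lebesgue_measure R]_(tau in `[a, b]) F tau i j.

Definition is_spd (R : realType) (n : nat) (M : 'M[R]_n) : Prop :=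
  M^T = M /\ forall x : 'cV[R]_n, x != 0 -> 0 < (x^T *m M *m x) 0 0.

(* The symmetric positive definite square root; it exists and is unique when M
   is symmetric positive definite (the default 0 is irrelevant then). *)
Definition sqrtmx (R : realType) (n : nat) (M : 'M[R]_n) : 'M[R]_n :=
  xget 0 [set S : 'M[R]_n | is_spd S /\ S *m S = M].

Definition kalman (R : realType) (n m : nat) (A : 'M[R]_n) (B : 'M[R]_(n, m)) :
    Prop :=
  \rank (\mxrow_(k < n) (A ^+ k *m B)) = n.

Definition gramian (R : realType) (n m : nat) (Ac : 'M[R]_n) (B : 'M[R]_(n, m))
    (t : R) : 'M[R]_n :=
  int_mx (fun tau : R =>
    expmx (- tau *: Ac) *m B *m B^T *m expmx (- tau *: Ac^T)) 0 t.

(* In finite dimension, continuity of all directional derivatives x |-> df_x(v)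
   is continuity of the differential x |-> df_x. *)
Definition C1 (R : realType) (n : nat) (f : 'cV[R]_n -> 'cV[R]_n) : Prop :=
  (forall x, differentiable f x) /\
  (forall v : 'cV[R]_n, continuous (fun x => 'D_v f x)).

(* Diffeomorphisms are taken in the C^1 sense, so that C^r and smooth ones are
   included. *)
Definition Diff (R : realType) (n : nat) : set ('cV[R]_n -> 'cV[R]_n) :=
  [set phi | exists g : 'cV[R]_n -> 'cV[R]_n,
     [/\ cancel phi g, cancel g phi, C1 phi & C1 g]].

Definition enorm (R : realType) (n : nat) (v : 'cV[R]_n) : R :=
  Num.sqrt (\sum_(i < n) v i 0 ^+ 2).

(* The library's is_contraction would refer to the sup norm on 'cV[R]_n. *)
Definition euclidean_contraction (R : realType) (n : nat)
    (psi : 'cV[R]_n -> 'cV[R]_n) : Prop :=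
  exists q : R, [/\ 0 <= q, q < 1 &
    forall x y, enorm (psi x - psi y) <= q * enorm (x - y)].

(* State trajectory and open-loop input of the minimum-energy transfer
   from xin at time 0 to phi xin at time ts for x' = Ac x + B u. *)
Definition xstar (R : realType) (n m : nat) (Ac : 'M[R]_n) (B : 'M[R]_(n, m))
    (ts : R) (phi : 'cV[R]_n -> 'cV[R]_n) (xin : 'cV[R]_n) (t : R) : 'cV[R]_n :=
  expmx (t *: Ac) *m
    (xin + gramian Ac B t *m invmx (gramian Ac B ts) *m (phi xin - xin)).

Definition ustar (R : realType) (n m : nat) (Ac : 'M[R]_n) (B : 'M[R]_(n, m))
    (ts : R) (phi : 'cV[R]_n -> 'cV[R]_n) (xin : 'cV[R]_n) (t : R) : 'cV[R]_m :=
  B^T *m expmx (- t *: Ac^T) *m invmx (gramian Ac B ts) *m (phi xin - xin).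

(* Main.v *)
(* Put S = W_ts^(1/2), y = S^-1 xin and M_t = S^-1 W_t S^-1. Then
   phi xin - xin = S psi(y), so that xstar = e^(t Ac) S (y + M_t psi(y)) and
   ustar = B^T e^(-t Ac^T) S^-1 psi(y). As 0 <= W_t <= W_ts, the symmetric matrix
   M_t satisfies 0 <= M_t <= I, hence is 1-Lipschitz in the Euclidean norm, and
   y |-> y + M_t psi(y) is a perturbation of the identity by a q-Lipschitz map
   with q < 1. So y is the fixed point of y |-> z - M_t psi(y), where
   z = S^-1 e^(-t Ac) xstar, and it depends continuously on (z, t) because
   (1 - q) |y - y0| <= |z - z0| + |(M_t - M_t0) psi(y0)|. *)

Require Import Defs.
From mathcomp Require Import all_boot all_order all_algebra.
From mathcomp Require Import all_classical all_reals all_analysis.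
From mathcomp Require Import lra.
Import Order.TTheory GRing.Theory Num.Theory.
Import numFieldNormedType.Exports.

Local Open Scope classical_set_scope.
Local Open Scope ring_scope.

Set Implicit Arguments.
Unset Strict Implicit.
Unset Printing Implicit Defensive.

(** * Entrywise convergence of matrices *)

(** Matrix balls are entrywise balls, and the finitely many index pairs admit one common
    neighbourhood. *)
Lemma cvg_mxP (R : realType) (T : Type) (F : set_system T) {FF : Filter F}
    (p q : nat) (f : T -> 'M[R]_(p, q)) (M : 'M[R]_(p, q)) :
  f @ F --> M <-> forall i j, f x i j @[x --> F] --> M i j.
Proof.
split=> [fM i j|fM].
  exact: (cvg_comp f (fun N : 'M[R]_(p, q) => N i j) fM
    (@coord_continuous _ _ _ i j M)).
apply/cvg_ballP => e e0.
have H : \forall x \near F, forall ij : 'I_p * 'I_q,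
    ball (M ij.1 ij.2) e (f x ij.1 ij.2).
  by apply: filter_forall => -[i j] /=; move/cvg_ballP: (fM i j); apply.
by apply: filterS H => x xH; split => // i j; exact: (xH (i, j)).
Qed.

Lemma cvg_mulmx (R : realType) (T : Type) (F : set_system T) {FF : Filter F}
    (p q r : nat) (f : T -> 'M[R]_(p, q)) (g : T -> 'M[R]_(q, r))
    (M : 'M[R]_(p, q)) (N : 'M[R]_(q, r)) :
  f @ F --> M -> g @ F --> N -> (f x *m g x) @[x --> F] --> M *m N.
Proof.
move=> /cvg_mxP fM /cvg_mxP gN; apply/cvg_mxP => i j.
under eq_fun do rewrite mxE.
rewrite mxE; apply: cvg_big => [|k _]; first exact: add_continuous.
exact: cvgM.
Qed.

Lemma cvg_mulmxr (R : realType) (T : Type) (F : set_system T) {FF : Filter F}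
    (p q r : nat) (f : T -> 'M[R]_(p, q)) (M : 'M[R]_(p, q)) (P : 'M[R]_(q, r)) :
  f @ F --> M -> (f x *m P) @[x --> F] --> M *m P.
Proof. by move=> fM; apply: cvg_mulmx => //; exact: cvg_cst. Qed.

Lemma cvg_mulmxl (R : realType) (T : Type) (F : set_system T) {FF : Filter F}
    (p q r : nat) (P : 'M[R]_(p, q)) (f : T -> 'M[R]_(q, r)) (M : 'M[R]_(q, r)) :
  f @ F --> M -> (P *m f x) @[x --> F] --> P *m M.
Proof. by move=> fM; apply: cvg_mulmx => //; exact: cvg_cst. Qed.

Arguments cvg_mulmxl {R T F FF p q r} P [f M].
Arguments cvg_mulmxr {R T F FF p q r} [f M] P.

Lemma cvg_trmx (R : realType) (T : Type) (F : set_system T) {FF : Filter F}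
    (p q : nat) (f : T -> 'M[R]_(p, q)) (M : 'M[R]_(p, q)) :
  f @ F --> M -> (f x)^T @[x --> F] --> M^T.
Proof.
move=> /cvg_mxP fM; apply/cvg_mxP => i j; under eq_fun do rewrite mxE.
rewrite mxE; exact: fM.
Qed.

Lemma cvg_mx_unique (R : realType) (p q : nat) (f : nat -> 'M[R]_(p, q))
    (M N : 'M[R]_(p, q)) :
  f @ \oo --> M -> f @ \oo --> N -> M = N.
Proof. by apply: cvg_unique; exact: norm_hausdorff. Qed.

(** * The matrix exponential along [t *: A] *)

Lemma exp_coef_mx (R : realType) (n : nat) (A : 'M[R]_n) (t : R) (k : nat) :
  (k`!%:R)^-1 *: (t *: A) ^+ k = (k`!%:R^-1 * t ^+ k) *: A ^+ k.
Proof.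
rewrite -scalerA; congr (_ *: _).
elim: k => [|k IH]; first by rewrite !expr0 scale1r.
rewrite !exprS IH.
by rewrite -[LHS]/((t *: A) *m (t ^+ k *: A ^+ k)) -scalemxAl -scalemxAr scalerA.
Qed.

(** The sum of all [|A i j|] dominates every absolute row sum, so each further factor [A] costs at
    most that sum. *)
Lemma norm_expr_mx_le (R : realType) (n : nat) (A : 'M[R]_n) (k : nat) i j :
  `|(A ^+ k) i j| <= (\sum_i \sum_j `|A i j|) ^+ k.
Proof.
elim: k i j => [|k IH] i j.
  by rewrite !expr0 mxE; case: eqP => _; rewrite /= ?normr1 ?normr0.
rewrite exprS -[A * _]/(A *m _) mxE.
apply: (le_trans (ler_norm_sum _ _ _)).
apply: (@le_trans _ _ ((\sum_j `|A i j|) * (\sum_i \sum_j `|A i j|) ^+ k)).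
  rewrite mulr_suml; apply: ler_sum => l _; rewrite normrM.
  by apply: ler_wpM2l.
rewrite exprS; apply: ler_wpM2r.
  by apply: exprn_ge0; apply: sumr_ge0 => ? _; apply: sumr_ge0.
rewrite [leRHS](bigD1 i) //= lerDl.
by apply: sumr_ge0 => ? _; apply: sumr_ge0.
Qed.

(** Makes the [limn] in [expmx] a genuine limit: each entry of the series is dominated by the scalar
    exponential series at [|t| * c]. *)
Lemma cvg_expmx (R : realType) (n : nat) (A : 'M[R]_n) (t : R) :
  series (fun k : nat => (k`!%:R)^-1 *: (t *: A) ^+ k) @ \oo --> expmx (t *: A).
Proof.
pose c := \sum_i \sum_j `|A i j|.
rewrite /expmx; set u := series _.
suff : cvgn u by [].
have cv i j : cvgn (series (fun k => k`!%:R^-1 * t ^+ k * (A ^+ k) i j)).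
  apply: normed_cvg.
  apply: (series_le_cvg _ _ _ (is_cvg_series_exp_coeff (`|t| * c))) => //=.
  - by move=> k; rewrite divr_ge0// exprn_ge0// mulr_ge0//;
      apply: sumr_ge0 => ? _; apply: sumr_ge0.
  move=> k; rewrite !normrM normfV normr_nat normrX /exp_coeff /= exprMn.
  rewrite -mulrA mulrC.
  by rewrite ler_wpM2r ?invr_ge0// ler_wpM2l ?exprn_ge0// norm_expr_mx_le.
apply/cvg_ex.
exists (\matrix_(i, j) limn (series (fun k => k`!%:R^-1 * t ^+ k * (A ^+ k) i j))).
apply/cvg_mxP => i j; rewrite mxE.
have -> : (fun x => u x i j) = series (fun k => k`!%:R^-1 * t ^+ k * (A ^+ k) i j).
  apply/funext => N; rewrite /u /series /= summxE; apply: eq_bigr => k _.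
  by rewrite exp_coef_mx mxE.
exact: cv.
Qed.

Arguments cvg_expmx {R n} A t.

(** The partial sums are polynomials in [A] and commute with it; pass to the limit. *)
Lemma expmx_comm (R : realType) (n : nat) (A : 'M[R]_n) (t : R) :
  A *m expmx (t *: A) = expmx (t *: A) *m A.
Proof.
set u := series (fun k : nat => (k`!%:R)^-1 *: (t *: A) ^+ k).
have h1 : A *m u N @[N --> \oo] --> A *m expmx (t *: A).
  by apply: cvg_mulmxl; exact: cvg_expmx.
have h2 : u N *m A @[N --> \oo] --> expmx (t *: A) *m A.
  by apply: cvg_mulmxr; exact: cvg_expmx.
apply: (cvg_mx_unique h1); rewrite (_ : (fun N => A *m u N) = fun N => u N *m A)//.
apply/funext => N; rewrite /u /series /= mulmx_sumr mulmx_suml.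
apply: eq_bigr => k _; rewrite exp_coef_mx -scalemxAl -scalemxAr.
by congr (_ *: _); rewrite -[LHS]/(A * A ^+ k) -[RHS]/(A ^+ k * A) -exprS -exprSr.
Qed.

Lemma expmx0 (R : realType) (n : nat) : expmx (0 : 'M[R]_n) = 1%:M.
Proof.
set u := series (fun k : nat => (k`!%:R)^-1 *: (0 *: 0 : 'M[R]_n) ^+ k).
(* The partial sum of index 0 is empty; from index 1 on they all equal the identity. *)
have h : u N.+1 @[N --> \oo] --> expmx (0 : 'M[R]_n).
  by rewrite cvg_shiftS; have := cvg_expmx (0 : 'M[R]_n) 0; rewrite -/u scale0r.
apply: (cvg_mx_unique h).
rewrite (_ : (fun N => u N.+1) = cst 1%:M); first exact: cvg_cst.
apply/funext => N /=; rewrite /u /series /= big_nat_recl//= big1 ?addr0.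
  by rewrite expr0 fact0 invr1 scale1r.
by move=> k _; rewrite scale0r exprS mul0r scaler0.
Qed.

Lemma expmx_tr (R : realType) (n : nat) (A : 'M[R]_n) (t : R) :
  expmx (t *: A^T) = (expmx (t *: A))^T.
Proof.
apply: (cvg_mx_unique (cvg_expmx A^T t)).
suff -> : series (fun k : nat => (k`!%:R)^-1 *: (t *: A^T) ^+ k) =
   (fun N => (series (fun k : nat => (k`!%:R)^-1 *: (t *: A) ^+ k) N)^T).
  by apply: cvg_trmx; exact: cvg_expmx.
apply/funext => N; rewrite /series /= raddf_sum; apply: eq_bigr => k _.
rewrite !exp_coef_mx (_ : A^T ^+ k = (A ^+ k)^T).
  by apply/matrixP => i j; rewrite !mxE.
elim: k => [|k IH]; first by rewrite !expr0 trmx1.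
by rewrite exprS IH exprSr -[RHS]/((A ^+ k *m A)^T) trmx_mul.
Qed.

(** Each entry of [expmx (s *: A) *m P] is a power series in [s] with coefficients [c P], and formal
    differentiation turns [P] into [A *m P]. The parameter [P] thus covers the series and its first
    two derivatives, whose convergence justifies differentiating termwise. *)
Lemma is_derive_expmx (R : realType) (n : nat) (A : 'M[R]_n) i j (t : R) :
  is_derive t 1 (fun s => expmx (s *: A) i j) ((expmx (t *: A) *m A) i j).
Proof.
pose c (P : 'M[R]_n) k := k`!%:R^-1 * (A ^+ k *m P) i j.
have cvgc P s : pseries (c P) s @ \oo --> (expmx (s *: A) *m P) i j.
  rewrite (_ : pseries _ _ = fun N =>
    (series (fun k : nat => (k`!%:R)^-1 *: (s *: A) ^+ k) N *m P) i j).
    by move: i j {c}; apply/cvg_mxP; apply: cvg_mulmxr; exact: cvg_expmx.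
  apply/funext => N; rewrite /pseries /series /= mulmx_suml summxE.
  apply: eq_bigr => k _.
  by rewrite exp_coef_mx -scalemxAl [RHS]mxE /c mulrAC.
have dc P : pseries_diffs (c P) = c (A *m P).
  apply/funext => k; rewrite /pseries_diffs /c factS natrM invfM mulrA.
  rewrite mulVKf ?pnatr_eq0//.
  by rewrite exprSr -[A ^+ k * A]/(A ^+ k *m A) mulmxA.
have e P s : limn (pseries (c P) s) = (expmx (s *: A) *m P) i j.
  exact/cvg_lim/cvgc.
(* Any point of modulus beyond [|t|] would do, as the series converge everywhere. *)
have := @pseries_snd_diffs _ (c 1%:M) (`|t| + 1) t.
rewrite !dc mulmx1 (e A t) => H.
rewrite (_ : (fun _ => _) = fun s => limn (pseries (c 1%:M) s)); last first.
  by apply/funext => s; rewrite e mulmx1.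
apply: H; try by apply/cvg_ex; eexists; exact: cvgc.
by rewrite [ltRHS]ger0_norm ?addr_ge0// ltrDl.
Qed.

Lemma is_derive_expmxN (R : realType) (n : nat) (A : 'M[R]_n) i j (t : R) :
  is_derive t 1 (fun s => expmx (- s *: A) i j) (- (expmx (- t *: A) *m A) i j).
Proof.
have h1 := is_derive_expmx A i j (- t).
have := is_derive1_comp h1 (is_deriveNid t 1).
by rewrite mulrN mulr1.
Qed.

Lemma continuous_expmxN (R : realType) (n : nat) (A : 'M[R]_n) :
  continuous (fun t : R => expmx (- t *: A)).
Proof.
move=> t; apply/cvg_mxP => i j.
have := is_derive_expmxN A i j t.
by move=> /@ex_derive /derivable1_diffP /differentiable_continuous.
Qed.

(** Each entry of the product has zero derivative in [t], because [A] commutes with the exponential,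
    and so keeps its value at 0. *)
Lemma expmxK (R : realType) (n : nat) (A : 'M[R]_n) (t : R) :
  expmx (t *: A) *m expmx (- t *: A) = 1%:M.
Proof.
apply/matrixP => i j.
pose f s := (expmx (s *: A) *m expmx (- s *: A)) i j.
suff : f t = f 0 by rewrite /f oppr0 scale0r expmx0 mulmx1.
apply: is_derive_0_is_cst => s.
pose g l s := expmx (s *: A) i l; pose h l s := expmx (- s *: A) l j.
have -> : f = \sum_l (g l * h l).
  by apply/funext => x; rewrite /f mxE fct_sumE.
have H := @is_derive_sum _ _ _ n (fun l => g l * h l) s 1 _
  (fun l => is_deriveM (is_derive_expmx A i l s) (is_derive_expmxN A l j s)).
apply: (is_derive_eq H).
rewrite big_split /=.
have -> : \sum_l g l s *: - (expmx (- s *: A) *m A) l j =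
    - (expmx (s *: A) *m (expmx (- s *: A) *m A)) i j.
  by rewrite [in RHS]mxE -sumrN; apply: eq_bigr => l _; rewrite /GRing.scale /= mulrN.
have -> : \sum_l h l s *: (expmx (s *: A) *m A) i l =
    (expmx (s *: A) *m A *m expmx (- s *: A)) i j.
  by rewrite [in RHS]mxE; apply: eq_bigr => l _; rewrite /GRing.scale /= mulrC.
by rewrite -mulmxA expmx_comm addNr.
Qed.

(** * The Euclidean norm and its compatibility with the topology *)

Lemma enormE (R : realType) (n : nat) (v : 'cV[R]_n) :
  enorm v = Num.sqrt ((v^T *m v) 0 0).
Proof.
by congr Num.sqrt; rewrite mxE; apply: eq_bigr => i _; rewrite mxE expr2.
Qed.

Lemma dotmx_ge0 (R : realType) (n : nat) (v : 'cV[R]_n) : 0 <= (v^T *m v) 0 0.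
Proof. by rewrite mxE; apply: sumr_ge0 => i _; rewrite mxE -expr2 sqr_ge0. Qed.

Lemma enorm_ge0 (R : realType) (n : nat) (v : 'cV[R]_n) : 0 <= enorm v.
Proof. exact: sqrtr_ge0. Qed.

Lemma sqr_enorm (R : realType) (n : nat) (v : 'cV[R]_n) :
  enorm v ^+ 2 = (v^T *m v) 0 0.
Proof. by rewrite enormE sqr_sqrtr// dotmx_ge0. Qed.

Lemma enormN (R : realType) (n : nat) (v : 'cV[R]_n) : enorm (- v) = enorm v.
Proof. by congr Num.sqrt; apply: eq_bigr => i _; rewrite mxE sqrrN. Qed.

Lemma ler_coord_enorm (R : realType) (n : nat) (v : 'cV[R]_n) i :
  `|v i 0| <= enorm v.
Proof.
rewrite -sqrtr_sqr ler_wsqrtr// (bigD1 i)//= lerDl.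
by apply: sumr_ge0 => j _; exact: sqr_ge0.
Qed.

Lemma enorm_eq0 (R : realType) (n : nat) (v : 'cV[R]_n) : enorm v = 0 -> v = 0.
Proof.
move=> v0; apply/matrixP => i j; rewrite ord1 mxE; apply/eqP.
by rewrite -normr_le0 -v0 ler_coord_enorm.
Qed.

(** By Cauchy-Schwarz, which comes from expanding the sum of the squares of [b * u i 0 - a * v i 0]
    and cancelling [a * b]; vectors of norm zero are treated apart for this division. *)
Lemma ler_enormD (R : realType) (n : nat) (u v : 'cV[R]_n) :
  enorm (u + v) <= enorm u + enorm v.
Proof.
have [/enorm_eq0 ->|u0] := eqVneq (enorm u) 0.
  by rewrite add0r lerDr enorm_ge0.
have [/enorm_eq0 ->|v0] := eqVneq (enorm v) 0.
  by rewrite addr0 lerDl enorm_ge0.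
set a := enorm u in u0 *; set b := enorm v in v0 *.
have a0 : 0 < a by rewrite lt_neqAle eq_sym u0 enorm_ge0.
have b0 : 0 < b by rewrite lt_neqAle eq_sym v0 enorm_ge0.
rewrite -(@ler_pXn2r _ 2)// ?nnegrE ?enorm_ge0 ?addr_ge0 ?(ltW a0) ?(ltW b0)//.
have Eu : \sum_i u i 0 ^+ 2 = a ^+ 2.
  by rewrite sqr_enorm mxE; apply: eq_bigr => i _; rewrite mxE expr2.
have Ev : \sum_i v i 0 ^+ 2 = b ^+ 2.
  by rewrite sqr_enorm mxE; apply: eq_bigr => i _; rewrite mxE expr2.
have CS : \sum_i u i 0 * v i 0 <= a * b.
  have : 0 <= \sum_i (b * u i 0 - a * v i 0) ^+ 2.
    by apply: sumr_ge0 => i _; exact: sqr_ge0.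
  rewrite (_ : \sum_i _ = b ^+ 2 * (\sum_i u i 0 ^+ 2)
     + a ^+ 2 * (\sum_i v i 0 ^+ 2)
     - 2 * a * b * \sum_i u i 0 * v i 0); last first.
    rewrite !mulr_sumr -big_split /= -sumrB; apply: eq_bigr => i _; lra.
  rewrite Eu Ev => H.
  have ab := mulr_gt0 a0 b0.
  rewrite -(ler_pM2l ab); move: H.
  set s := \sum_i _ => H; nra.
rewrite sqr_enorm mxE.
under eq_bigr do rewrite !mxE -expr2 sqrrD.
rewrite !big_split /= Eu Ev sqrrD mulr2n.
by rewrite lerD2r lerD2l lerD.
Qed.

(** With its converse [enorm_cvg], this moves between the sup-norm topology and Euclidean
    estimates. *)
Lemma cvg_enorm (R : realType) (n : nat) (T : Type) (F : set_system T)
    {FF : Filter F} (f : T -> 'cV[R]_n) (l : 'cV[R]_n) :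
  f @ F --> l -> enorm (f x - l) @[x --> F] --> 0.
Proof.
move=> /cvg_mxP fl.
rewrite -[X in _ --> X]sqrtr0.
apply: continuous_cvg; first exact: sqrt_continuous.
rewrite [X in _ --> X](_ : 0 =
  \sum_(i < n) (l i 0 - l i 0) * (l i 0 - l i 0)); last first.
  by rewrite big1// => i _; rewrite subrr mul0r.
apply: cvg_big => [|i _]; first exact: add_continuous.
under eq_fun do rewrite !mxE expr2.
by apply: cvgM; apply: cvgB => //; exact: cvg_cst.
Qed.

Lemma enorm_cvg (R : realType) (n : nat) (T : Type) (F : set_system T)
    {FF : Filter F} (f : T -> 'cV[R]_n) (l : 'cV[R]_n) :
  enorm (f x - l) @[x --> F] --> 0 -> f @ F --> l.
Proof.
move=> /cvgr0Pnorm_lt H; apply/cvg_mxP => i j; rewrite ord1.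
apply/cvgrPdist_lt => e e0.
apply: filterS (H e e0) => x; rewrite ger0_norm ?enorm_ge0//.
apply: le_lt_trans; rewrite distrC.
by have := ler_coord_enorm (f x - l) i; rewrite !mxE.
Qed.

Lemma enorm_lipschitz_cvg (R : realType) (n : nat) (T : Type) (F : set_system T)
    {FF : Filter F} (f : T -> 'cV[R]_n) (l : 'cV[R]_n) (q : R)
    (g : 'cV[R]_n -> 'cV[R]_n) :
  (forall x y, enorm (g x - g y) <= q * enorm (x - y)) ->
  f @ F --> l -> (g \o f) @ F --> g l.
Proof.
move=> gq /cvg_enorm fl; apply: enorm_cvg.
apply: (@squeeze_cvgr _ _ _ _ (cst 0) (fun x => q * enorm (f x - l))).
- by apply: nearW => x /=; rewrite enorm_ge0 gq.
- exact: cvg_cst.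
- by rewrite -[X in _ --> X](mulr0 q); apply: cvgM => //; exact: cvg_cst.
Qed.

(** * Fixed points of Euclidean contractions *)

(** Picard iteration from 0: successive differences decay geometrically, and the limit is fixed
    because [g] is continuous. *)
Lemma euclidean_contraction_fixpoint (R : realType) (n : nat)
    (g : 'cV[R]_n -> 'cV[R]_n) :
  euclidean_contraction g -> exists p, p = g p.
Proof.
case=> q [q0 q1 gq].
pose y k := iter k g 0.
have dy k : enorm (y k.+1 - y k) <= enorm (y 1%N - y 0%N) * q ^+ k.
  elim: k => [|k IH]; first by rewrite expr0 mulr1.
  apply: (le_trans (gq _ _)); rewrite exprS mulrCA; exact: ler_wpM2l.
have cy i : cvgn (fun k => y k i 0).
  (* Each coordinate is a telescoping series dominated by a geometric one. *)
  have ct : cvgn (series (telescope (fun k => y k i 0))).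
    apply: normed_cvg.
    have q1' : `|q| < 1 by rewrite ger0_norm.
    apply: (series_le_cvg _ _ _ (is_cvg_geometric_series
      (a := enorm (y 1%N - y 0%N)) q1')) => k /=.
    - by [].
    - by rewrite mulr_ge0 ?enorm_ge0 ?exprn_ge0.
    - apply: le_trans (dy k).
      by have := ler_coord_enorm (y k.+1 - y k) i; rewrite !mxE.
  rewrite telescopeK in ct.
  rewrite (_ : (fun k => y k i 0) = (fun k => (y k i 0 - y 0%N i 0) + y 0%N i 0)).
    by apply: is_cvgD => //; exact: is_cvg_cst.
  by apply/funext => k; rewrite subrK.
pose p : 'cV[R]_n := \col_i limn (fun k => y k i 0).
have yp : y @ \oo --> p.
  by apply/cvg_mxP => i j; rewrite ord1 mxE; exact: cy.
exists p.
have yS : y k.+1 @[k --> \oo] --> p by rewrite cvg_shiftS.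
apply: (cvg_mx_unique yS).
exact: (enorm_lipschitz_cvg gq yp).
Qed.

(** * Quadratic forms and integrals of continuous matrix functions *)

(** No diagonalization: positivity at [x - P *m x] and the upper bound at [P *m x] add up to $x^T
    P^2 x \le x^T P x$, and the right side is at most $x^T x$. *)
Lemma ler_enorm_mulmx_psd (R : realType) (n : nat) (P : 'M[R]_n) :
  P^T = P -> (forall x : 'cV[R]_n, 0 <= (x^T *m P *m x) 0 0) ->
  (forall x : 'cV[R]_n, (x^T *m P *m x) 0 0 <= (x^T *m x) 0 0) ->
  forall x : 'cV[R]_n, enorm (P *m x) <= enorm x.
Proof.
move=> PT P0 P1 x; rewrite !enormE ler_wsqrtr//; apply: le_trans (P1 x).
rewrite trmx_mul PT -subr_ge0.
have h1 := P0 (x - P *m x).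
have h2 := P1 (P *m x).
move: h1 h2; rewrite [(_ - _)^T]linearB /= trmx_mul PT !(mulmxBl, mulmxBr) !mulmxA.
by rewrite !mxE => h1 h2; lra.
Qed.

Lemma continuous_integrable_itv (R : realType) (f : R -> R) (a b : R) :
  continuous f -> (@lebesgue_measure R).-integrable `[a, b] (EFin \o f).
Proof.
move=> cf; apply: continuous_compact_integrable; first exact: segment_compact.
exact: continuous_subspaceT.
Qed.

Lemma continuous_sum (R : realType) (I : Type) (r : seq I) (F : I -> R -> R) :
  (forall i, continuous (F i)) -> continuous (fun x => \sum_(i <- r) F i x).
Proof.
by move=> cF; apply: continuous_big => // ; exact: add_continuous.
Qed.

Lemma Rintegral_itv_sum (R : realType) (I : Type) (r : seq I) (F : I -> R -> R)
    (a b : R) :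
  (forall i, continuous (F i)) ->
  \int[@lebesgue_measure R]_(x in `[a, b]) (\sum_(i <- r) F i x) =
  \sum_(i <- r) \int[@lebesgue_measure R]_(x in `[a, b]) F i x.
Proof.
move=> cF; elim: r => [|i r IH].
  rewrite big_nil; under eq_Rintegral do rewrite big_nil.
  by rewrite Rintegral_cst// mul0r.
rewrite big_cons; under eq_Rintegral do rewrite big_cons.
rewrite RintegralD ?IH//; apply: continuous_integrable_itv => //.
exact: continuous_sum.
Qed.

(** A quadratic form is a linear combination of entries, hence commutes with the entrywise integral.
    Order relations between Gramians thereby reduce to signs of integrands. *)
Lemma int_mx_quad (R : realType) (n : nat) (F : R -> 'M[R]_n) (a b : R)
    (x : 'cV[R]_n) :
  continuous F ->
  (x^T *m int_mx F a b *m x) 0 0 =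
  \int[@lebesgue_measure R]_(s in `[a, b]) ((x^T *m F s *m x) 0 0).
Proof.
move=> cF.
have quadE (M : 'M[R]_n) :
    (x^T *m M *m x) 0 0 = \sum_i \sum_j (x j 0 * x i 0) * M j i.
  rewrite mxE; apply: eq_bigr => i _; rewrite mxE mulr_suml.
  by apply: eq_bigr => j _; rewrite mxE mulrAC.
have cc i j : continuous (fun s => x j 0 * x i 0 * F s j i).
  move=> s; apply: cvgM; first exact: cvg_cst.
  by move: j i; apply/cvg_mxP; exact: cF.
rewrite quadE; under eq_Rintegral do rewrite quadE.
rewrite Rintegral_itv_sum => [|i]; last by apply: continuous_sum => j; exact: cc.
apply: eq_bigr => i _; rewrite Rintegral_itv_sum//.
apply: eq_bigr => j _; rewrite RintegralZl ?mxE//.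
apply: continuous_integrable_itv => s.
by move: j i; apply/cvg_mxP; exact: cF.
Qed.

(** * The Gramian: symmetry, positivity, monotonicity and continuity in time *)

Section gramian.
Context {R : realType} {n m : nat} (Ac : 'M[R]_n) (B : 'M[R]_(n, m)).

Let G (tau : R) := expmx (- tau *: Ac) *m B *m B^T *m expmx (- tau *: Ac^T).

(** The form $N N^T$ gives both symmetry and nonnegativity of the integrand. *)
Lemma gramian_density_sqr tau :
  G tau = (expmx (- tau *: Ac) *m B) *m (expmx (- tau *: Ac) *m B)^T.
Proof. by rewrite /G expmx_tr trmx_mul !mulmxA. Qed.

Lemma continuous_gramian_density : continuous G.
Proof.
move=> t; apply: cvg_mulmx; last exact: continuous_expmxN.
by do 2 apply: cvg_mulmxr; exact: continuous_expmxN.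
Qed.

Lemma gramian_tr t : (gramian Ac B t)^T = gramian Ac B t.
Proof.
apply/matrixP => i j; rewrite !mxE; apply: eq_Rintegral => s _.
have : (G s)^T = G s by rewrite gramian_density_sqr trmx_mul trmxK.
by move=> /matrixP/(_ i j); rewrite mxE.
Qed.

Lemma gramian_density_ge0 tau (x : 'cV[R]_n) : 0 <= (x^T *m G tau *m x) 0 0.
Proof.
rewrite gramian_density_sqr mulmxA -mulmxA.
set v := _^T *m x.
rewrite (_ : _ *m _ = v^T) ?dotmx_ge0//.
by rewrite /v trmx_mul trmxK.
Qed.

Lemma gramian_psd t (x : 'cV[R]_n) : 0 <= (x^T *m gramian Ac B t *m x) 0 0.
Proof.
rewrite int_mx_quad; last exact: continuous_gramian_density.
by apply: Rintegral_ge0 => s _; exact: gramian_density_ge0.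
Qed.

(** The difference is the integral of a nonnegative function between [t] and [s]. *)
Lemma gramian_le t s (x : 'cV[R]_n) : 0 <= t <= s ->
  (x^T *m gramian Ac B t *m x) 0 0 <= (x^T *m gramian Ac B s *m x) 0 0.
Proof.
move=> /andP[t0 ts].
rewrite !int_mx_quad; try exact: continuous_gramian_density.
rewrite -subr_ge0 Rintegral_itvB ?bnd_simp//.
  by apply: Rintegral_ge0 => r _; exact: gramian_density_ge0.
apply: continuous_integrable_itv => r.
have : x^T *m G s *m x @[s --> r] --> x^T *m G r *m x.
  by apply: cvg_mulmxr; apply: cvg_mulmxl; exact: continuous_gramian_density.
by move/cvg_mxP; exact.
Qed.

Lemma gramian_within_continuous (ts : R) : 0 <= ts ->
  {within `[0, ts], continuous (gramian Ac B)}.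
Proof.
move=> ts0; apply/subspace_continuousP => t tts.
apply/cvg_mxP => i j; rewrite mxE.
under eq_fun do rewrite mxE.
have iG : (@lebesgue_measure R).-integrable `[0, ts] (EFin \o (fun s => G s i j)).
  apply: continuous_integrable_itv => s.
  by move: i j; apply/cvg_mxP; exact: continuous_gramian_density.
have := parameterized_integral_continuous ts0 iG.
by move=> /subspace_continuousP/(_ t tts).
Qed.

End gramian.

(** * Positive definite matrices and the square root *)

Lemma spd_unitmx (R : realType) (n : nat) (M : 'M[R]_n) :
  is_spd M -> M \in unitmx.
Proof.
move=> [MT M0]; rewrite -row_free_unit; apply: inj_row_free => v vM.
apply/eqP; rewrite -(inj_eq trmx_inj) trmx0; apply: contraT => /M0.
by rewrite trmxK vM mul0mx mxE ltxx.
Qed.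

(* [sqrtmx M] is the junk value [0] when [M] has no square root; then [psi] is
   [- id] up to a constant, which is not a contraction. *)
Lemma contraction_sqrtmx (R : realType) (n : nat) (M : 'M[R]_n)
    (phi : 'cV[R]_n -> 'cV[R]_n) : (1 <= n)%N ->
  euclidean_contraction (fun x : 'cV[R]_n =>
    invmx (sqrtmx M) *m phi (sqrtmx M *m x) - x) ->
  is_spd (sqrtmx M) /\ sqrtmx M *m sqrtmx M = M.
Proof.
(* The all-ones vector and 0 serve as test points; they differ since the dimension is positive. *)
case: n M phi => // n M phi _ [q [q0 q1 /(_ (const_mx 1) 0)]].
have [ex|nex] := pselect (exists S : 'M[R]_n.+1, is_spd S /\ S *m S = M).
  by move=> _; exact: (xgetPex 0 ex).
have -> : sqrtmx M = 0 by apply: xgetPN => S /= HS; apply: nex; exists S.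
rewrite !(mul0mx, subr0) addrAC subrr sub0r => H.
suff /matrixP/(_ 0 0)/eqP : const_mx 1 = 0 :> 'cV[R]_n.+1.
  by rewrite !mxE oner_eq0.
apply: enorm_eq0; apply/eqP; rewrite eq_le enorm_ge0 andbT.
rewrite enormN in H.
have := enorm_ge0 (const_mx 1 : 'cV[R]_n.+1).
by move: H; set e := enorm _ => H e0; nra.
Qed.

(** * Construction and continuity of the feedback law *)

Theorem proposition6 (R : realType) (n m : nat) (n_ge1 : (1 <= n)%N)
    (m_ge1 : (1 <= m)%N)
    (A : 'M[R]_n) (B : 'M[R]_(n, m)) (B_full_col_rank : \rank B = m)
    (AB_kalman : kalman A B)
    (ts : R) (ts_gt0 : 0 < ts)
    (Kc : 'M[R]_(m, n)) (exp_Ac_ts : expmx (ts *: (A + B *m Kc)) = 1%:M)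
    (phi : 'cV[R]_n -> 'cV[R]_n) (phi_diff : Diff phi)
    (psi_contraction :
       let W := gramian (A + B *m Kc) B in
       euclidean_contraction (fun x : 'cV[R]_n =>
         invmx (sqrtmx (W ts)) *m phi (sqrtmx (W ts) *m x) - x)) :
  exists K : 'cV[R]_n * R -> 'cV[R]_m,
    {within [set: 'cV[R]_n] `*` `[0, ts], continuous K} /\
    forall (xin : 'cV[R]_n) (t : R), 0 <= t <= ts ->
      ustar (A + B *m Kc) B ts phi xin t =
      K (xstar (A + B *m Kc) B ts phi xin t, t).
Proof.
have [Sspd SS] := contraction_sqrtmx n_ge1 psi_contraction.
move: psi_contraction => /=; rewrite /ustar /xstar.
set Ac := A + B *m Kc in Sspd SS *; set W := gramian Ac B in SS *.
set S := sqrtmx (W ts) in Sspd SS *; set psi := fun x => _.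
case=> q [q0 q1 psiq].
have uS := spd_unitmx Sspd; have ST : S^T = S := Sspd.1.
have uW : W ts \in unitmx by rewrite -SS unitmx_mul uS.
have WS : invmx (W ts) *m S = invmx S.
  by rewrite -[RHS](mulKmx uW) -{3}SS mulmxK.
have phiE x : phi x - x = S *m psi (invmx S *m x).
  by rewrite /psi mulKVmx// mulmxBr !mulKVmx.
pose M t := invmx S *m W t *m invmx S.
have MT t : (M t)^T = M t by rewrite !trmx_mul trmx_inv ST gramian_tr mulmxA.
have quadM t (x : 'cV[R]_n) :
    x^T *m M t *m x = (invmx S *m x)^T *m W t *m (invmx S *m x).
  by rewrite trmx_mul trmx_inv ST !mulmxA.
have M1 t (x : 'cV[R]_n) : 0 <= t <= ts -> enorm (M t *m x) <= enorm x.
  move=> tts; apply: ler_enorm_mulmx_psd => // {}x; rewrite quadM.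
    exact: gramian_psd.
  (* Once [W t] is replaced by [W ts], which is [S *m S], the form at [invmx S *m x] collapses to
     $x^T x$. *)
  apply: (le_trans (gramian_le _ _ _ tts)).
  by rewrite -/W -SS trmx_mul trmx_inv ST !mulmxA mulmxKV// mulmxK.
pose z (p : 'cV[R]_n * R) := invmx S *m expmx (- p.2 *: Ac) *m p.1.
(* Stability of the fixed point at a fixed time: it gives continuity below, and uniqueness when
   [u = v]. *)
have fixE t (u v : 'cV[R]_n) y y' : 0 <= t <= ts ->
    y = u - M t *m psi y -> y' = v - M t *m psi y' ->
    (1 - q) * enorm (y - y') <= enorm (u - v).
  move=> tts yE y'E.
  have : enorm (y - y') <= enorm (u - v) + q * enorm (y - y').
    rewrite {1}yE {1}y'E.
    rewrite (_ : _ - _ = (u - v) - (M t *m psi y - M t *m psi y')); last first.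
      by rewrite !opprB [LHS]addrACA [RHS]addrACA [- v - _]addrC.
    apply: (le_trans (ler_enormD _ _)); rewrite lerD2l enormN -mulmxBr.
    exact: le_trans (M1 _ _ tts) (psiq _ _).
  by rewrite mulrBl mul1r lerBlDr.
(* The default 0 can occur only at times outside [[0, ts]], where [K] is not constrained. *)
pose Y p := xget 0 [set y | y = z p - M p.2 *m psi y].
have YE p : 0 <= p.2 <= ts -> Y p = z p - M p.2 *m psi (Y p).
  move=> tts; rewrite /Y; case: xgetP => //= nex.
  have [|y yE] := @euclidean_contraction_fixpoint _ _
      (fun y => z p - M p.2 *m psi y); last by have := nex y; rewrite /= -yE.
  exists q; split => // x y; rewrite opprB addrC subrKA -mulmxBr.
  by rewrite -(opprB y x) enormN (le_trans (M1 _ _ tts)).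
exists (fun p => B^T *m expmx (- p.2 *: Ac^T) *m (invmx S *m psi (Y p))); split.
  apply/subspace_continuousP => -[x0 t0] /= [_ t0ts].
  set D := _ `*` _; set F := within D _.
  have c1 : p.1 @[p --> F] --> x0 by apply: cvg_within_filter; exact: cvg_fst.
  have c2 : p.2 @[p --> F] --> t0 by apply: cvg_within_filter; exact: cvg_snd.
  (* Continuity of the Gramian is available only within [[0, ts]], so time must converge in that
     finer sense. *)
  have c2w : p.2 @[p --> F] --> within `[0, ts] (nbhs t0).
    move=> P /= HP.
    have : nbhs (x0, t0) (fun p : 'cV[R]_n * R => `[0, ts]%classic p.2 -> P p.2).
      have h : p.2 @[p --> (x0, t0)] --> t0 by exact: cvg_snd.
      exact: (h _ HP).
    by apply: filterS => p /= H [_ /H].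
  have cW : W p.2 @[p --> F] --> W t0.
    apply: (cvg_comp _ _ c2w).
    have /subspace_continuousP :=
      @gramian_within_continuous _ _ _ Ac B _ (ltW ts_gt0).
    exact.
  have cE (P : 'M[R]_n) : expmx (- p.2 *: P) @[p --> F] --> expmx (- t0 *: P).
    apply: (cvg_comp _ (fun s => expmx (- s *: P)) c2); exact: continuous_expmxN.
  have cz : z p @[p --> F] --> z (x0, t0).
    by apply: cvg_mulmx c1; apply: cvg_mulmxl; exact: cE.
  set y0 := Y (x0, t0).
  have y0E : y0 = z (x0, t0) - M t0 *m psi y0 by exact: YE.
  have cM : M p.2 *m psi y0 @[p --> F] --> M t0 *m psi y0.
    by do 2 apply: cvg_mulmxr; apply: cvg_mulmxl.
  have cY : Y @ F --> y0.
    apply: enorm_cvg.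
    pose d p := enorm (z p - z (x0, t0)) +
      enorm (M p.2 *m psi y0 - M t0 *m psi y0).
    apply: (@squeeze_cvgr _ _ _ _ (cst 0) (fun p => (1 - q)^-1 * d p)).
    - have : \forall p \near F, D p by exact: withinT.
      apply: filterS => p [_ /=]; rewrite in_itv /= => pts.
      rewrite enorm_ge0 /=.
      rewrite ler_pdivlMl ?subr_gt0//.
      set w := M p.2 *m psi y0 - M t0 *m psi y0.
      (* [y0] belongs to time [t0]; moving the change of [M] into the data makes it a fixed point at
         time [p.2], so that [fixE] compares it with [Y p]. *)
      have y0E' : y0 = z (x0, t0) + w - M p.2 *m psi y0.
        by rewrite addrA addrAC addrK.
      apply: (le_trans (fixE _ _ _ _ _ pts (YE p pts) y0E')).
      by rewrite opprD addrA (le_trans (ler_enormD _ _))// enormN.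
    - exact: cvg_cst.
    - rewrite -[X in _ --> X](mulr0 (1 - q)^-1) -[X in _ * X](addr0 0).
      by apply: cvgM; [exact: cvg_cst|apply: cvgD; exact: cvg_enorm].
  apply: cvg_mulmx; first by apply: cvg_mulmxl; exact: cE.
  by apply: cvg_mulmxl; exact: enorm_lipschitz_cvg psiq cY.
(* Both sides now differ only in the argument of [psi]: it remains to identify [invmx S *m xin] with
   [Y] at the current state. *)
move=> xin t tts /=; rewrite phiE mulmxA -(mulmxA _ (invmx _) S) WS -[LHS]mulmxA.
congr (_ *m (_ *m psi _)).
set p := (_, t); set y := invmx S *m xin.
have EK : expmx (- t *: Ac) *m expmx (t *: Ac) = 1%:M.
  by rewrite -{2}(opprK t) expmxK.
have yE : y = z p - M t *m psi y.
  rewrite /z /p /= !mulmxA -(mulmxA (invmx S)) EK mulmx1 mulmxDr -/y.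
  by rewrite -(mulmxA _ (invmx (W ts)) S) WS !mulmxA addrK.
apply/eqP; rewrite -subr_eq0; apply/eqP/enorm_eq0.
(* Both points solve the same equation, so their distance is zero. *)
have := fixE _ _ _ _ _ tts yE (YE p tts).
rewrite subrr [enorm 0]enormE mulmx0 mxE sqrtr0 => H.
apply/eqP; rewrite eq_le enorm_ge0 andbT.
by rewrite -(pmulr_rle0 _ (_ : 0 < 1 - q)) ?subr_gt0.
Qed.
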